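(* Let $\ell\ge 7$ be odd. There is an $\ell$-cycle decomposition of $K_{4\ell+1}$ together with a $2$-colouring of $V(K_{4\ell+1})$ which is equitable for this decomposition and whose two colour classes have sizes $2\ell$ and $2\ell+1$.
   Context: An $\ell$-cycle decomposition of a graph is a set of $\ell$-cycles whose edge sets partition the edge set of the graph. A $2$-colouring of the vertices is equitable for the decomposition if every cycle contains either $\lfloor \ell/2\rfloor$ or $\lceil \ell/2\rceil$ vertices of each colour. *)

(* Defs.v *)
(* A simple graph on the vertex type T is given by its edge
   set, a set of two-element subsets of T. *)
From HB Require Import structures.
From mathcomp Require Import all_boot.
Set Implicit Arguments.
Unset Strict Implicit.
Unset Printing Implicit Defensive.

Definition complete_graph (T : finType) : {set {set T}} :=
  [set e : {set T} | #|e| == 2].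

(* For duplicate-free s, [next s] is the cyclic successor, so this is the edge
   set of the closed walk s_0 s_1 ... s_(l-1) s_0. *)
Definition cycle_edges (T : finType) (s : seq T) : {set {set T}} :=
  [set [set x; next s x] | x in s].

(* A cycle has no isolated vertex, so as a subgraph it is determined by its
   edge set C, and its vertex set is [cover C]. *)
Definition is_cycle (T : finType) (l : nat) (C : {set {set T}}) : Prop :=
  2 < l /\ exists s : l.-tuple T, uniq s /\ C = cycle_edges s.

Definition cycle_decomposition (T : finType) (l : nat) (E : {set {set T}})
    (D : {set {set {set T}}}) : Prop :=
  (forall C : {set {set T}}, C \in D -> is_cycle l C) /\ partition D E.

Definition colour_class (T : finType) (c : T -> bool) (b : bool) : {set T} :=
  [set x | c x == b].

(* [l./2] and [uphalf l] are the floor and the ceiling of l/2. *)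
Definition equitable (T : finType) (l : nat) (D : {set {set {set T}}})
    (c : T -> bool) : Prop :=
  forall (C : {set {set T}}) (b : bool), C \in D ->
    #|cover C :&: colour_class c b| = l./2 \/
    #|cover C :&: colour_class c b| = uphalf l.

(* Main.v *)
(* Identify the vertices with the residues 0, ..., n - 1 modulo n = 4l + 1,
   colour them by parity, and take all translates modulo n of two base cycles.

   Every edge has a difference d with 1 <= d <= 2l, so these 2n cycles cover
   K_n as soon as each such d occurs on one of the two base cycles; since
   2nl is the number of edges of K_n, the cover is then a partition.

   Suppose that the sorted vertices of a base cycle alternate in parity. As n
   is odd, translation by t changes the parity of exactly those vertices that
   do not wrap around if t is odd, and of those that do if t is even; so the
   translated sequence of colours alternates up to one defect, and each colour
   occurs l./2 or uphalf l times.

   With l = 2k + 1, one base cycle is a zigzag using the differences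
   1, ..., 2k + 2 except one value c, which is k - 1 for k even and k + 1 for k
   odd; the other is a zigzag using c and 2k + 3, ..., 4k + 2. *)
Require Import Defs.
From HB Require Import structures.
From mathcomp Require Import all_boot zify.
Set Implicit Arguments.
Unset Strict Implicit.
Unset Printing Implicit Defensive.

(** * Sums of alternating bits *)

Lemma sum_alternating (b : bool) (q : nat) :
  \sum_(i < q) (b (+) odd i) = (q + b)./2.
Proof.
elim: q => [|q IHq]; first by rewrite big_ord0; case: (b).
by rewrite big_ord_recr /= IHq; case: (b); case Oq: (odd q) => /=; lia.
Qed.

(** The terms before [p] and those from [p] on form two alternating runs. As [l] is odd, exactly one
    run has odd length; the even one is balanced, so only one half gets rounded. *)
Lemma sum_alternating_defect (b : bool) (l p : nat) :
  odd l -> p <= l ->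
  \sum_(i < l) (b (+) odd i (+) (p <= i)) = l./2 \/
  \sum_(i < l) (b (+) odd i (+) (p <= i)) = uphalf l.
Proof.
move=> odd_l le_pl; rewrite -(subnKC le_pl) big_split_ord /=.
rewrite (eq_bigr (fun i : 'I_p => nat_of_bool (b (+) odd i))); last first.
  by move=> i _; rewrite leqNgt ltn_ord addbF.
rewrite (eq_bigr (fun i : 'I_(l - p) => nat_of_bool (~~ (b (+) odd p) (+) odd i)));
  last first.
  by move=> i _; rewrite leq_addr oddD; case: b (odd p) (odd i) => [] [] [].
by rewrite !sum_alternating subnKC //; case: b => /=; case Op: (odd p) => /=; lia.
Qed.

(** * Translation of vertex lists modulo [n] *)

Definition residue (n : nat) (n_gt0 : 0 < n) (m : nat) : 'I_n :=
  Ordinal (ltn_pmod m n_gt0).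

Definition translate (n : nat) (n_gt0 : 0 < n) (vs : seq nat) (t : 'I_n) : seq 'I_n :=
  [seq residue n_gt0 (v + t) | v <- vs].

Lemma translate_uniq (n : nat) (n_gt0 : 0 < n) (vs : seq nat) (t : 'I_n) :
  uniq vs -> {in vs, forall v, v < n} -> uniq (translate n_gt0 vs t).
Proof.
move=> uniq_vs lt_vs; rewrite map_inj_in_uniq // => v w /lt_vs ltv /lt_vs ltw.
move=> /(congr1 val) /= /eqP; rewrite eqn_modDr => /eqP.
by rewrite !modn_small.
Qed.

Lemma odd_residue (n : nat) (n_gt0 : 0 < n) (v : nat) (t : 'I_n) :
  odd n -> v < n -> odd (residue n_gt0 (v + t)) = odd v (+) odd t (+) (n - t <= v).
Proof.
move=> odd_n ltvn /=; have ltn := ltn_ord t; case: leqP => le_n.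
  have le_nvt: n <= v + t by lia.
  rewrite -(subnK le_nvt) modnDr modn_small; last by lia.
  by rewrite oddB // odd_n oddD.
by rewrite modn_small ?oddD ?addbF //; lia.
Qed.

(** * Edges and vertices of a cycle *)

Lemma next_nth_uniq (T : eqType) (x0 : T) (s : seq T) (i : nat) :
  uniq s -> i < size s -> next s (nth x0 s i) = nth x0 s (i.+1 %% size s).
Proof.
move=> uniq_s lt_is; rewrite next_nth mem_nth // index_uniq //.
case: s uniq_s lt_is => //= y s _; rewrite ltnS leq_eqVlt.
(* At the last position [next] falls back on the default of [nth], which is the head [y]: this is
   the wrap-around. *)
case/predU1P=> [-> | lt_is]; first by rewrite modnn nth_default.
by rewrite modn_small //=; apply: set_nth_default.
Qed.

Lemma cover_cycle_edges (T : finType) (s : seq T) :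
  cover (cycle_edges s) = [set x in s].
Proof.
apply/setP=> x; rewrite inE; apply/bigcupP/idP.
  by case=> _ /imsetP[y y_s ->]; rewrite !inE => /pred2P[] ->; rewrite ?mem_next.
by move=> x_s; exists [set x; next s x]; rewrite ?set21 //; apply/imsetP; exists x.
Qed.

Lemma edge_cycle_edges (T : finType) (x0 : T) (s : seq T) (i : nat) :
  uniq s -> i < size s ->
  [set nth x0 s i; nth x0 s (i.+1 %% size s)] \in cycle_edges s.
Proof.
move=> uniq_s lt_is; apply/imsetP; exists (nth x0 s i); first exact: mem_nth.
by rewrite next_nth_uniq.
Qed.

Lemma cycle_edges_complete (T : finType) (s : seq T) :
  uniq s -> 1 < size s -> cycle_edges s \subset complete_graph T.
Proof.
case: s => // x0 s1; set s := x0 :: s1 => uniq_s s_gt1.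
apply/subsetP=> _ /imsetP[_ /(nthP x0)[i lt_is <-] ->].
rewrite inE cards2 next_nth_uniq // nth_uniq ?ltn_mod ?(ltnW s_gt1) //.
have [lt_i1 | ge_i1] := ltnP i.+1 (size s); first by rewrite modn_small // neq_ltn ltnSn.
have def_s: i.+1 = size s by apply/eqP; rewrite eqn_leq lt_is.
by rewrite def_s modnn; have ->: i != 0 by rewrite -lt0n -ltnS def_s.
Qed.

Lemma card_cycle_edges (T : finType) (s : seq T) : #|cycle_edges s| <= size s.
Proof.
rewrite (leq_trans (leq_imset_card _ _)) //.
by apply: leq_trans (card_size s); apply: subset_leq_card; apply/subsetP.
Qed.

(** * Base cycles whose sorted vertices alternate in parity *)

Lemma mkseq_increasing (g : nat -> nat) (l : nat) :
  (forall i, i.+1 < l -> g i < g i.+1) ->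
  forall i j, i < j < l -> g i < g j.
Proof.
move=> incr_g i; elim=> // j IHj /andP[le_ij lt_jl].
have:= incr_g j lt_jl; move: le_ij; rewrite ltnS leq_eqVlt.
by case/predU1P=> [-> // | lt_ij]; apply: ltn_trans; rewrite IHj // lt_ij ltnW.
Qed.

(* [g] lists the vertices of the base cycle [f 0, ..., f l.-1] in increasing
   order; that the [f i] are pairwise distinct follows by counting. *)
Definition alternating_enumeration (n l : nat) (f g : nat -> nat) : Prop :=
  [/\ forall i, i < l -> exists2 j, j < l & f j = g i,
      forall i, i.+1 < l -> g i < g i.+1,
      forall i, i.+1 < l -> odd (g i.+1) = ~~ odd (g i)
    & forall i, i < l -> g i < n].

Lemma alternating_enumeration_perm (n l : nat) (f g : nat -> nat) :
  alternating_enumeration n l f g ->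
  [/\ uniq (mkseq f l), uniq (mkseq g l) & perm_eq (mkseq f l) (mkseq g l)].
Proof.
case=> sub_gf incr_g _ _.
have uniq_g: uniq (mkseq g l).
  apply/mkseq_uniqP=> i j; rewrite !inE => lt_il lt_jl.
  have lt_g := mkseq_increasing incr_g.
  have [lt_ij | lt_ji | //] := ltngtP i j => eq_g.
    by have:= lt_g i j; rewrite lt_ij lt_jl eq_g ltnn => /(_ isT).
  by have:= lt_g j i; rewrite lt_ji lt_il eq_g ltnn => /(_ isT).
have sub: {subset mkseq g l <= mkseq f l}.
  move=> x /mapP[i]; rewrite mem_iota => /= lt_il ->.
  have [j lt_jl <-] := sub_gf i lt_il.
  by apply: map_f; rewrite mem_iota.
have le_size: size (mkseq f l) <= size (mkseq g l) by rewrite !size_mkseq.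
have uniq_f := leq_size_uniq uniq_g sub le_size.
have [_ eq_gf] := uniq_min_size uniq_g sub le_size.
by split=> //; apply: uniq_perm => // x; rewrite eq_gf.
Qed.

Lemma count_translate (n : nat) (n_gt0 : 0 < n) (l : nat) (f g : nat -> nat)
    (t : 'I_n) (b : bool) :
  odd n -> odd l -> alternating_enumeration n l f g ->
  count (fun x : 'I_n => odd x == b) (translate n_gt0 (mkseq f l) t) = l./2 \/
  count (fun x : 'I_n => odd x == b) (translate n_gt0 (mkseq f l) t) = uphalf l.
Proof.
move=> odd_n odd_l fgP; have [_ _ perm_fg] := alternating_enumeration_perm fgP.
case: fgP => _ incr_g odd_g lt_gn; have lt_g := mkseq_increasing incr_g.
rewrite count_map (permP perm_fg) count_map.
(* As [g] increases, the vertices that wrap past [n] form a final segment; [p] is where it starts,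
   and equals [l] when none wraps. *)
pose p := find (fun i => n - t <= g i) (iota 0 l).
have le_pl: p <= l by rewrite -[l in _ <= l](size_iota 0) find_size.
have pP i : i < l -> (n - t <= g i) = (p <= i).
  move=> lt_il; case: (leqP p i) => [le_pi | lt_ip].
    have lt_pl := leq_ltn_trans le_pi lt_il.
    have: has (fun i => n - t <= g i) (iota 0 l) by rewrite has_find size_iota.
    move/(nth_find 0); rewrite -/p nth_iota // => /leq_trans-> //.
    move: le_pi; rewrite leq_eqVlt => /predU1P[-> // | lt_pi].
    by rewrite ltnW ?lt_g ?lt_pi.
  by have:= before_find 0 lt_ip; rewrite nth_iota.
have odd_gE i : i < l -> odd (g i) = odd (g 0) (+) odd i.
  elim: i => [|i IHi] lt_il; first by rewrite addbF.
  by rewrite odd_g // IHi ?(ltnW lt_il) //= addbN.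
suff ->: count (preim g (preim (fun v => residue n_gt0 (v + t))
           (fun x : 'I_n => odd x == b))) (iota 0 l) =
         \sum_(i < l) (odd (g 0) (+) odd t (+) ~~ b (+) odd i (+) (p <= i)).
  exact: sum_alternating_defect.
rewrite -sum1_count big_mkcond /= -[l in iota 0 l]subn0 big_mkord.
apply: eq_bigr => i _; rewrite -[_ %% n]/(residue n_gt0 (g i + t) : nat).
rewrite odd_residue ?lt_gn // pP // odd_gE //.
by case: (odd (g 0)) (odd t) (odd i) b (p <= i) => [] [] [] [] [].
Qed.

(** * Differences and cyclic development *)

Definition has_difference (n l : nat) (f : nat -> nat) (d : nat) : Prop :=
  exists2 i, i < l &
    f i + d = f (i.+1 %% l) %[mod n] \/ f (i.+1 %% l) + d = f i %[mod n].

(** Equality up to one [n] in place of the congruence leaves linear arithmetic once [f] is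
    unfolded. *)
Lemma has_difference_step (n l : nat) (f : nat -> nat) (d i : nat) :
  i.+1 < l ->
  (f i + d = f i.+1 \/ f i + d = f i.+1 + n) \/
  (f i.+1 + d = f i \/ f i.+1 + d = f i + n) ->
  has_difference n l f d.
Proof.
move=> lt_il diff_i; exists i; first exact: ltnW.
by rewrite (modn_small lt_il); case: diff_i => -[] ->; rewrite ?modnDr; auto.
Qed.

Lemma has_difference_closing (n l : nat) (f : nat -> nat) (d : nat) :
  (f l + d = f 0 \/ f l + d = f 0 + n) \/
  (f 0 + d = f l \/ f 0 + d = f l + n) ->
  has_difference n l.+1 f d.
Proof.
move=> diff_l; exists l => //.
by rewrite modnn; case: diff_l => -[] ->; rewrite ?modnDr; auto.
Qed.

Lemma cyclic_development (n l : nat) (f0 g0 f1 g1 : nat -> nat) :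
  2 < l -> odd l -> n = 4 * l + 1 ->
  alternating_enumeration n l f0 g0 -> alternating_enumeration n l f1 g1 ->
  (forall d, 0 < d <= 2 * l -> has_difference n l f0 d \/ has_difference n l f1 d) ->
  exists D : {set {set {set 'I_n}}},
    cycle_decomposition l (complete_graph 'I_n) D /\
    equitable l D (fun x : 'I_n => odd x).
Proof.
move=> l_gt2 odd_l def_n fg0P fg1P diffP.
have n_gt0: 0 < n by rewrite def_n addn1.
have odd_n: odd n by rewrite def_n oddD oddM.
pose F (b : bool) := if b then f1 else f0.
have FP b : exists g, alternating_enumeration n l (F b) g.
  by case: b; [exists g1 | exists g0].
pose cyc (bt : bool * 'I_n) := translate n_gt0 (mkseq (F bt.1) l) bt.2.
have size_cyc bt : size (cyc bt) = l by rewrite size_map size_mkseq.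
have uniq_cyc bt : uniq (cyc bt).
  have [g gP] := FP bt.1; have [uniq_f _ perm_fg] := alternating_enumeration_perm gP.
  apply: translate_uniq => // v; rewrite (perm_mem perm_fg) => /mapP[i].
  by rewrite mem_iota => /= lt_il ->; case: gP => _ _ _; apply.
pose D := [set cycle_edges (cyc bt) | bt in [set: bool * 'I_n]].
have sub_cyc bt : cycle_edges (cyc bt) \subset complete_graph 'I_n.
  by rewrite cycle_edges_complete // size_cyc ltnW.
have edgeP (x y : 'I_n) d : 0 < d <= 2 * l -> y = x + d %[mod n] ->
  [set x; y] \in cover D.
- move=> /diffP diff_d def_y.
  have [b [i lt_il diff_i]] : exists b, has_difference n l (F b) d.
    by case: diff_d; [exists false | exists true].
  set f := F b in diff_i.
  have lt_i1l: i.+1 %% l < l by rewrite ltn_mod; lia.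
  have nthE bt j : j < l -> nth x (cyc bt) j = residue n_gt0 (F bt.1 j + bt.2).
    by move=> lt_jl; rewrite (nth_map 0) ?size_mkseq // nth_mkseq.
  have coverP (t : 'I_n) : [set residue n_gt0 (f i + t); residue n_gt0 (f (i.+1 %% l) + t)]
      \in cover D.
    apply/bigcupP; exists (cycle_edges (cyc (b, t))); first exact: imset_f.
    have:= @edge_cycle_edges _ x (cyc (b, t)) i (uniq_cyc _).
    by rewrite size_cyc !nthE //; apply.
  (* Modulo [n], [n.-1 * a] is [- a], so the witness is [x - a]. *)
  have solve a : exists t : 'I_n, residue n_gt0 (a + t) = x.
    exists (residue n_gt0 (x + n.-1 * a)); apply: val_inj => /=.
    rewrite modnDmr addnCA -mulSn prednK // addnC mulnC modnMDl.
    by rewrite modn_small.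
  have shift a a' (t : 'I_n) :
    residue n_gt0 (a + t) = x -> a + d = a' %[mod n] -> residue n_gt0 (a' + t) = y.
  - move=> /(congr1 val)/= at_x aa'; apply: val_inj => /=.
    rewrite -modnDml -aa' modnDml addnAC -modnDml.
    by rewrite at_x -def_y modn_small.
  case: diff_i => diff_i.
    have [t at_x] := solve (f i).
    by rewrite -(shift _ _ _ at_x diff_i) -at_x; exact: coverP.
  have [t at_x] := solve (f (i.+1 %% l)).
  by rewrite setUC -(shift _ _ _ at_x diff_i) -at_x; exact: coverP.
have cover_D : cover D = complete_graph 'I_n.
  apply/eqP; rewrite eqEsubset; apply/andP; split.
    by apply/bigcupsP=> _ /imsetP[bt _ ->]; exact: sub_cyc.
  apply/subsetP=> e; rewrite inE => /cards2P[x [y [neq_xy ->]]].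
  wlog lt_xy: x y neq_xy / x < y.
    move=> IH; have [lt_xy | lt_yx | eq_xy] := ltngtP x y; first exact: IH.
      by rewrite setUC; apply: IH; rewrite // eq_sym.
    by case/eqP: neq_xy; apply: val_inj.
  have lt_yn := ltn_ord y.
  have [le_d | gt_d] := leqP (y - x) (2 * l).
    by apply: (edgeP _ _ (y - x)); [lia | rewrite subnKC // ltnW].
  (* Vertices more than [2 * l] apart are joined the other way round: [n - (y - x)] is at most
     [2 * l]. *)
  rewrite setUC; apply: (edgeP _ _ (n + x - y)); first lia.
  by rewrite subnKC ?modnDl //; lia.
have card_edges : #|complete_graph 'I_n| = n * (2 * l).
  rewrite card_draws card_ord bin2 def_n addn1 /=.
  by have ->: 4 * l = (2 * l).*2; [lia | rewrite -doubleMr doubleK].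
have card_D : #|D| <= 2 * n.
  by rewrite (leq_trans (leq_imset_card _ _)) // cardsT card_prod card_bool card_ord.
(* Disjointness is equality of the sum of the sizes with the size of the cover: at most [2 * n]
   members of at most [l] edges cover [n * (2 * l)] edges. *)
have triv_D : trivIset D.
  rewrite /trivIset cover_D eqn_leq -{2}cover_D (leq_card_cover D) andbT card_edges.
  apply: (@leq_trans (\sum_(C in D) l)); last by rewrite sum_nat_const; nia.
  apply: leq_sum => _ /imsetP[bt _ ->].
  by rewrite (leq_trans (card_cycle_edges _)) // size_cyc.
exists D; split; first split.
- move=> _ /imsetP[bt _ ->]; split=> //.
  by exists (Tuple (introT eqP (size_cyc bt))); split=> //; exact: uniq_cyc.
- rewrite /partition cover_D eqxx triv_D /=; apply/imsetP=> -[bt _ set0_bt].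
  have def_s := size_cyc bt.
  have [x x_s] : exists x, x \in cyc bt.
    by case: (cyc bt) def_s l_gt2 => [<-|x s _ _] //; exists x; rewrite mem_head.
  have: [set x; next (cyc bt) x] \in cycle_edges (cyc bt) by apply/imsetP; exists x.
  by rewrite -set0_bt inE.
- move=> _ b /imsetP[[b' t] _ ->].
  have [g gP] := FP b'.
  rewrite cover_cycle_edges.
  have ->: [set x in cyc (b', t)] :&: colour_class (fun x : 'I_n => odd x) b =
           [set x in filter (fun x : 'I_n => odd x == b) (cyc (b', t))].
    by apply/setP=> x; rewrite !inE mem_filter andbC.
  rewrite cardsE (card_uniqP _) ?filter_uniq // size_filter.
  exact: (count_translate _ _ _ odd_n odd_l gP).
Qed.

(** * The explicit zigzags *)

(* 0, 2k + 2, 1, 2k + 1, 2, ..., k: the differences decrease from 2k + 2 to 1,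
   omitting two consecutive values at the place where the upper vertices skip
   two numbers; the closing edge k -- 0 restores one of the two. *)
Definition small_cycle (k i : nat) : nat :=
  if odd i then (if i./2 <= k./2 then 2 * k + 2 - i./2 else 2 * k - i./2)
  else i./2.

(** The skipped numbers are [2 * k - k./2] and its successor; the resulting step of 3 is odd, so
    parities still alternate. *)
Definition small_cycle_enum (k i : nat) : nat :=
  if i < 2 * k - k./2 then i else i.+2.

(* 0, 4k + 6, 1, 4k + 2, 4, 4k + 1, 5, ..., k + 1, 3k + 4, 4k + 3: the first
   two edges and the last one have differences exceeding n / 2, which count as
   4k - 1, 4k and 4k + 2. *)
Definition large_cycle_even (k i : nat) : nat :=
  if i == 0 then 0 else if i == 1 then 4 * k + 6 else if i == 2 then 1
  else if i == 2 * k then 4 * k + 3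
  else if odd i then 4 * k + 3 - i./2 else i./2 + 2.

Definition large_cycle_even_enum (k i : nat) : nat :=
  if i < 2 then i else if i < k then i + 2
  else if i < 2 * k then 2 * k + 4 + i else 4 * k + 6.

(* 0, 2k + 4, 1, 7k + 5, 3k + 4, 7k + 4, 3k + 5, ..., 4k + 2: the edge from 1
   to 7k + 5 has difference k + 1 modulo n. *)
Definition large_cycle_odd (k i : nat) : nat :=
  if i == 0 then 0 else if i == 1 then 2 * k + 4 else if i == 2 then 1
  else if odd i then 7 * k + 6 - i./2 else 3 * k + 2 + i./2.

Definition large_cycle_odd_enum (k i : nat) : nat :=
  if i < 2 then i else if i == 2 then 2 * k + 4
  else if i < k + 2 then 3 * k + 1 + i else 5 * k + 5 + i.

(** * Sorted vertices of the zigzags *)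

Ltac case_lia := repeat (case: ifP => ?); rewrite /=; lia.

Lemma small_cycle_enumP (k : nat) :
  2 < k ->
  alternating_enumeration (8 * k + 5) (2 * k + 1) (small_cycle k) (small_cycle_enum k).
Proof.
move=> k_gt2; split=> i lt_i; rewrite /small_cycle_enum /small_cycle; last first.
- by case_lia.
- by case_lia.
- by case_lia.
(* Even positions carry the lower vertices in ascending order, odd positions the upper ones in
   descending order. *)
have [le_ik | lt_ki] := leqP i k.
  by exists (2 * i); case_lia.
by exists (4 * k + 1 - 2 * i); case_lia.
Qed.

Lemma large_cycle_even_enumP (k : nat) :
  2 < k ->
  alternating_enumeration (8 * k + 5) (2 * k + 1)
    (large_cycle_even k) (large_cycle_even_enum k).
Proof.
move=> k_gt2; split=> i lt_i; rewrite /large_cycle_even_enum /large_cycle_even;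
  last first.
- by case_lia.
- by case_lia.
- by case_lia.
have [lt_i2 | le_2i] := ltnP i 2; first by exists (2 * i); case_lia.
have [lt_ik | le_ki] := ltnP i k; first by exists (2 * i); case_lia.
have [lt_i2k1 | ge_i2k1] := ltnP i (2 * k - 1);
  first by exists (4 * k - 1 - 2 * i); case_lia.
have [eq_i | ne_i] := eqVneq i (2 * k); first by exists 1; case_lia.
by exists (2 * k); case_lia.
Qed.

(** The step from [2 * k + 4] to [3 * k + 4] is [k], which is odd here; the other steps are 1,
    [2 * k + 3] and [2 * k + 5]. *)
Lemma large_cycle_odd_enumP (k : nat) :
  odd k -> 2 < k ->
  alternating_enumeration (8 * k + 5) (2 * k + 1)
    (large_cycle_odd k) (large_cycle_odd_enum k).
Proof.
move=> odd_k k_gt2; split=> i lt_i; rewrite /large_cycle_odd_enum /large_cycle_odd;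
  last first.
- by case_lia.
- by case_lia.
- by case_lia.
have [lt_i2 | le_2i] := ltnP i 2; first by exists (2 * i); case_lia.
have [eq_i2 | ne_i2] := eqVneq i 2; first by exists 1; case_lia.
have [lt_ik | le_ki] := ltnP i (k + 2); first by exists (2 * (i - 1)); case_lia.
by exists (4 * k + 3 - 2 * i); case_lia.
Qed.

(** * Differences of the zigzags *)

Lemma small_cycle_difference (k d : nat) :
  2 < k -> 0 < d <= 2 * k + 2 -> d != (if odd k then k + 1 else k - 1) ->
  has_difference (8 * k + 5) (2 * k + 1) (small_cycle k) d.
Proof.
move=> k_gt2 d_bound d_neq.
have [eq_dk | neq_dk] := eqVneq d k.
  by rewrite addn1; apply: has_difference_closing; rewrite /small_cycle; case_lia.
(* The edge at position [i] has difference [2 * k + 2 - i] before the skip and [2 * k - i] after it;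
   even positions go up, odd ones down. *)
have [le_d | gt_d] := leqP d (2 * k - 2 * (k./2).+1).
  by apply: (@has_difference_step _ _ _ _ (2 * k - d)); [lia |];
    case odd_d: (odd d); [right; left | left; left];
    move: d_neq; rewrite /small_cycle; case_lia.
by apply: (@has_difference_step _ _ _ _ (2 * k + 2 - d)); [lia |];
  case odd_d: (odd d); [right; left | left; left];
  move: d_neq; rewrite /small_cycle; case_lia.
Qed.

Lemma large_cycle_even_difference (k d : nat) :
  2 < k -> 2 * k + 3 <= d <= 4 * k + 2 \/ d = k - 1 ->
  has_difference (8 * k + 5) (2 * k + 1) (large_cycle_even k) d.
Proof.
move=> k_gt2 d_cases.
have [eq_d | neq_d] := eqVneq d (4 * k + 2).
  by rewrite addn1; apply: has_difference_closing; rewrite /large_cycle_even; case_lia.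
have [eq_d | neq_dk] := eqVneq d (k - 1).
  by apply: (@has_difference_step _ _ _ _ (2 * k - 1)); [lia |];
    left; left; rewrite /large_cycle_even; case_lia.
(* Positions 3 to [2 * k - 2] give [4 * k + 1 - i]; positions 0, 1, 2 give the three values above
   [4 * k - 2] that remain. *)
have [le_d | gt_d] := leqP d (4 * k - 2).
  by apply: (@has_difference_step _ _ _ _ (4 * k + 1 - d)); [lia |];
    case odd_d: (odd d); [left; left | right; left]; rewrite /large_cycle_even; case_lia.
have [eq_d | neq_d1] := eqVneq d (4 * k - 1).
  by apply: (@has_difference_step _ _ _ _ 0); [lia |]; right; right;
    rewrite /large_cycle_even; case_lia.
have [eq_d | neq_d2] := eqVneq d (4 * k).
  by apply: (@has_difference_step _ _ _ _ 1); [lia |]; left; right;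
    rewrite /large_cycle_even; case_lia.
by apply: (@has_difference_step _ _ _ _ 2); [lia |]; left; left;
  rewrite /large_cycle_even; case_lia.
Qed.

Lemma large_cycle_odd_difference (k d : nat) :
  odd k -> 2 < k -> 2 * k + 3 <= d <= 4 * k + 2 \/ d = k + 1 ->
  has_difference (8 * k + 5) (2 * k + 1) (large_cycle_odd k) d.
Proof.
move=> odd_k k_gt2 d_cases.
have [eq_d | neq_d] := eqVneq d (4 * k + 2).
  by rewrite addn1; apply: has_difference_closing; rewrite /large_cycle_odd; case_lia.
have [eq_d | neq_dk] := eqVneq d (k + 1).
  by apply: (@has_difference_step _ _ _ _ 2); [lia |]; right; right;
    rewrite /large_cycle_odd; case_lia.
have [eq_d | neq_d4] := eqVneq d (2 * k + 4).
  by apply: (@has_difference_step _ _ _ _ 0); [lia |]; left; left;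
    rewrite /large_cycle_odd; case_lia.
have [eq_d | neq_d3] := eqVneq d (2 * k + 3).
  by apply: (@has_difference_step _ _ _ _ 1); [lia |]; right; left;
    rewrite /large_cycle_odd; case_lia.
(* From position 3 on, the edge at [i] has difference [4 * k + 4 - i], down to [2 * k + 5]. *)
by apply: (@has_difference_step _ _ _ _ (4 * k + 4 - d)); [lia |];
  case odd_d: (odd d); [right; left | left; left]; rewrite /large_cycle_odd; case_lia.
Qed.

(** * The decomposition and its colour classes *)

Theorem theorem5 (l : nat) (hl : 7 <= l) (hodd : odd l) :
  exists (D : {set {set {set 'I_(4 * l + 1)}}}) (c : 'I_(4 * l + 1) -> bool),
    [/\ cycle_decomposition l (complete_graph 'I_(4 * l + 1)) D,
        equitable l D c &
        exists b : bool, #|colour_class c b| = 2 * l /\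
                         #|colour_class c (~~ b)| = 2 * l + 1].
Proof.
have [k def_l] : exists k, l = 2 * k + 1 by exists l./2; lia.
have k_gt2 : 2 < k by lia.
have def_n : 4 * l + 1 = 8 * k + 5 by lia.
have l_gt2 : 2 < l by lia.
have [D [decD eqD]] : exists D : {set {set {set 'I_(4 * l + 1)}}},
    cycle_decomposition l (complete_graph 'I_(4 * l + 1)) D /\
    equitable l D (fun x : 'I_(4 * l + 1) => odd x).
  have smallP := small_cycle_enumP k_gt2.
  case odd_k: (odd k).
    apply: (cyclic_development (f0 := small_cycle k) (f1 := large_cycle_odd k)) => //;
      rewrite ?def_n ?def_l.
    - exact: smallP.
    - exact: large_cycle_odd_enumP.
    - move=> d d_bound.
      have [le_d | gt_d] := leqP d (2 * k + 2); last first.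
        by right; apply: large_cycle_odd_difference => //; lia.
      have [eq_d | neq_d] := eqVneq d (k + 1).
        by right; apply: large_cycle_odd_difference => //; right.
      by left; apply: small_cycle_difference => //; [lia | rewrite odd_k].
  apply: (cyclic_development (f0 := small_cycle k) (f1 := large_cycle_even k)) => //;
    rewrite ?def_n ?def_l.
  - exact: smallP.
  - exact: large_cycle_even_enumP.
  - move=> d d_bound.
    have [le_d | gt_d] := leqP d (2 * k + 2); last first.
      by right; apply: large_cycle_even_difference => //; lia.
    have [eq_d | neq_d] := eqVneq d (k - 1).
      by right; apply: large_cycle_even_difference => //; right.
    by left; apply: small_cycle_difference => //; [lia | rewrite odd_k].
exists D, (fun x => odd x); split=> //.
have card_odd b : #|colour_class (fun x : 'I_(4 * l + 1) => odd x) b| = 2 * l + ~~ b.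
  rewrite -sum1dep_card big_mkcond /=.
  transitivity (\sum_(i < 4 * l + 1) (~~ b (+) odd i)).
    by apply: eq_bigr => i _; case: b (odd i) => [] [].
  by rewrite sum_alternating; case: b; lia.
by exists true; rewrite !card_odd addn0.
Qed.
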